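(* Let $\{X_i\}_{i\in I}$ be a small family of Hausdorff and core-compact topological spaces. The canonical bijection $$\prod_{i\in I}{}^{\mathrm f}\ \mathrm{Exp}_{\mathrm T}(X_i)\longrightarrow\mathrm{Exp}_{\mathrm T}\Big(\coprod_{i\in I}X_i\Big),\qquad (S_i)_{i\in I}\mapsto\bigcup_{i\in I}S_i,$$ is a homeomorphism.
   Context: For a topological space $X$, the topological exponential $\mathrm{Exp}_{\mathrm T}(X)$ is the set of all finite subsets of $X$ (including the empty one, written $[\emptyset]$) with the finest topology making the maps $X^n\to\mathrm{Exp}_{\mathrm T}(X)$, $(x_1,\dots,x_n)\mapsto\{x_1,\dots,x_n\}$, continuous for all $n\ge 0$. It is pointed by $[\emptyset]$. For pointed topological spaces $\{Y_i\}_{i\in I}$, the finite product is $\prod^{\mathrm f}_{i\in I}Y_i:=\varinjlim_{J\subset I\text{ finite}}\prod_{j\in J}Y_j$ (colimit in topological spaces, with transition maps induced by the base points). Its points are the families $(y_i)_{i\in I}$ with all but finitely many $y_i$ equal to the base point. A space $X$ is core-compact if the functor $Y\mapsto X\times Y$ on topological spaces commutes with colimits. *)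

(* Defs.v *)
From HB Require Import structures.
From mathcomp Require Import all_boot all_order finmap.
From mathcomp Require Import all_classical.
From mathcomp Require Import topology.

Set Implicit Arguments.
Unset Strict Implicit.
Unset Printing Implicit Defensive.

Local Open Scope fset_scope.
Local Open Scope classical_set_scope.

Definition homeomorphism (S T : topologicalType) (f : S -> T) : Prop :=
  exists g : T -> S,
    [/\ cancel f g, cancel g f, continuous f & continuous g].

Record category := Category {
  cat_obj :> Type;
  cat_hom : cat_obj -> cat_obj -> Type;
  cat_id : forall a, cat_hom a a;
  cat_comp : forall a b c, cat_hom b c -> cat_hom a b -> cat_hom a c;
  cat_compl : forall a b (u : cat_hom a b), cat_comp (cat_id b) u = u;
  cat_compr : forall a b (u : cat_hom a b), cat_comp u (cat_id a) = u;
  cat_compA : forall a b c d (w : cat_hom c d) (v : cat_hom b c)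
    (u : cat_hom a b), cat_comp w (cat_comp v u) = cat_comp (cat_comp w v) u
}.

Record diagram (J : category) := Diagram {
  diag_obj :> J -> topologicalType;
  diag_map : forall a b, cat_hom a b -> diag_obj a -> diag_obj b;
  diag_map_continuous : forall a b (u : cat_hom a b), continuous (diag_map u);
  diag_map_id : forall a, diag_map (cat_id a) =1 id;
  diag_map_comp : forall a b c (v : cat_hom b c) (u : cat_hom a b),
    diag_map (cat_comp v u) =1 diag_map v \o diag_map u
}.

Definition is_cocone (J : category) (D : diagram J) (T : topologicalType)
    (t : forall a, D a -> T) : Prop :=
  (forall a, continuous (t a)) /\
  (forall a b (u : cat_hom a b), t b \o diag_map u =1 t a).

Definition is_colimit (J : category) (D : diagram J) (L : topologicalType)
    (c : forall a, D a -> L) : Prop :=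
  is_cocone c /\
  forall (T : topologicalType) (t : forall a, D a -> T), is_cocone t ->
    exists! h : L -> T, continuous h /\ forall a, h \o c a =1 t a.

Definition prod_map (X Y Z : Type) (f : Y -> Z) (p : X * Y) : X * Z :=
  (p.1, f p.2).

Lemma prod_map_continuous (X Y Z : topologicalType) (f : Y -> Z) :
  continuous f -> continuous (@prod_map X Y Z f).
Proof.
move=> cf p; apply: cvg_pair; first exact: cvg_fst.
by apply: (cvg_comp _ _ cvg_snd); exact: cf.
Qed.

Section prod_diagram.
Variables (X : topologicalType) (J : category) (D : diagram J).

Let obj (a : J) : topologicalType := (X * D a)%type.
Let map a b (u : cat_hom a b) : obj a -> obj b := prod_map (diag_map u).

Let map_continuous a b (u : cat_hom a b) : continuous (map u).
Proof. exact/prod_map_continuous/diag_map_continuous. Qed.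

Let map_id a : map (cat_id a) =1 id.
Proof. by case=> x y; rewrite /map /prod_map /= diag_map_id. Qed.

Let map_comp a b c (v : cat_hom b c) (u : cat_hom a b) :
  map (cat_comp v u) =1 map v \o map u.
Proof. by case=> x y; rewrite /map /prod_map /= diag_map_comp. Qed.

Definition prod_diagram : diagram J := Diagram map_continuous map_id map_comp.

End prod_diagram.

(** [X * _] commutes with colimits: it maps colimiting cocones to colimiting
    cocones. *)
Definition core_compact (X : topologicalType) : Prop :=
  forall (J : category) (D : diagram J) (L : topologicalType)
    (c : forall a, D a -> L),
  is_colimit c ->
  @is_colimit J (prod_diagram X D) (X * L)%type (fun a => prod_map (c a)).

(** [final_topology f] is an alias of [T] carrying the finest topology for which
    all the maps [f k : A k -> T] are continuous. *)

Definition final_topology (K : Type) (A : K -> topologicalType) (T : Type)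
  (f : forall k, A k -> T) : Type := T.

Section final_topology.
Variables (K : Type) (A : K -> topologicalType) (T : choiceType).
Variable f : forall k, A k -> T.
Local Notation W := (final_topology f).

Definition final_open : set_system W :=
  [set U | forall k, open (@f k @^-1` U)].

Let final_openT : final_open setT.
Proof. by move=> k; rewrite preimage_setT; exact: openT. Qed.

Let final_openI : setI_closed final_open.
Proof. by move=> U V oU oV k; rewrite preimage_setI; exact: openI. Qed.

Let final_open_bigU (I : Type) (g : I -> set W) :
  (forall i, final_open (g i)) -> final_open (\bigcup_i g i).
Proof.
by move=> og k; rewrite preimage_bigcup; apply: bigcup_open => i _; exact: og.
Qed.

HB.instance Definition _ := Choice.on W.
HB.instance Definition _ :=
  isOpenTopological.Build W final_openT final_openI final_open_bigU.

Lemma final_openE : open = final_open.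
Proof. by []. Qed.

Lemma final_continuous k : continuous (@f k : A k -> W).
Proof. by apply/continuousP => U; exact. Qed.

Lemma final_continuousP (Z : topologicalType) (g : W -> Z) :
  continuous g <-> forall k, continuous (g \o @f k).
Proof.
split=> [cg k x|cg].
  by apply: continuous_comp; [exact: final_continuous|exact: cg].
apply/continuousP => U oU; rewrite final_openE => k.
by move/continuousP: (cg k) => /(_ U oU).
Qed.

End final_topology.

(** Finite subsets of [X] are elements of [{fset X}], and [X^n] is the product of
    copies of [X] indexed by ['I_n]. *)

Definition fset_of_family (X : topologicalType) (n : nat)
  (x : {ptws 'I_n -> X}) : {fset X} := [fset x k | k : 'I_n]%fset.

Definition ExpT (X : topologicalType) : Type :=
  final_topology (@fset_of_family X).

HB.instance Definition _ (X : topologicalType) := Topological.on (ExpT X).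
HB.instance Definition _ (X : topologicalType) :=
  isPointed.Build (ExpT X) (fset0 : {fset X}).

Lemma prod_topology_continuous (K : Type) (Y : K -> topologicalType)
    (T : topologicalType) (g : T -> prod_topology Y) :
  (forall k, continuous (fun t => g t k)) -> continuous g.
Proof.
move=> cg t; apply/cvg_sup => k; move: t.
apply/(@continuousP _ (initial_topology (fun y : forall k, Y k => y k))).
by move=> _ [B oB <-]; move/continuousP: (cg k) => /(_ B oB).
Qed.

Record finprod_set (I : choiceType) (Y : I -> ptopologicalType) := FProd {
  finprod_fun :> forall i, Y i;
  finprod_finite : finite_set [set i | finprod_fun i <> point]
}.

HB.instance Definition _ (I : choiceType) (Y : I -> ptopologicalType) :=
  gen_eqMixin (finprod_set Y).
HB.instance Definition _ (I : choiceType) (Y : I -> ptopologicalType) :=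
  gen_choiceMixin (finprod_set Y).

Section finprod.
Variables (I : choiceType) (Y : I -> ptopologicalType).

Lemma finprod_eqP (y z : finprod_set Y) : (forall i, y i = z i) -> y = z.
Proof.
case: y z => [y hy] [z hz] /= yz.
have {}yz : y = z by apply: functional_extensionality_dep.
by case: _ / yz hz => hz; congr FProd; exact: Prop_irrelevance.
Qed.

Definition base_extend (J : {fset I}) (z : forall j : J, Y (val j)) (i : I) : Y i :=
  match @idP (i \in J) with
  | ReflectT iJ => z [` iJ]
  | ReflectF _ => point
  end.

Lemma base_extend_in (J : {fset I}) (z : forall j : J, Y (val j)) (j : J) :
  base_extend z (val j) = z j.
Proof.
rewrite /base_extend; case: {-}_ / idP => [jJ|]; last by have := valP j.
by case: j jJ => i ij jJ; rewrite (bool_irrelevance jJ ij).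
Qed.

Lemma base_extend_out (J : {fset I}) (z : forall j : J, Y (val j)) (i : I) :
  i \notin J -> base_extend z i = point.
Proof. by move/negP=> iJ; rewrite /base_extend; case: {-}_ / idP. Qed.

Lemma base_extend_finite (J : {fset I}) (z : forall j : J, Y (val j)) :
  finite_set [set i | base_extend z i <> point].
Proof.
apply: (sub_finite_set _ (finite_fset J)) => i /= zi.
by apply: contrapT => /negP iJ; apply: zi; exact: base_extend_out.
Qed.

Definition finprod_in (J : {fset I})
    (z : prod_topology (fun j : J => Y (val j))) : finprod_set Y :=
  FProd (base_extend_finite z).

Definition finprod : Type := final_topology finprod_in.

HB.instance Definition _ := Topological.on finprod.

End finprod.

(** [finprod Y] is the colimit, over the finite subsets [J] of [I] ordered by
    inclusion, of the products of the [Y j] for [j] in [J]. *)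

Section finprod_colimit.
Variables (I : choiceType) (Y : I -> ptopologicalType).

Let fsub (J K : {fset I}) : Type := (J `<=` K)%fset.
Let fsub_id (J : {fset I}) : fsub J J := fsubset_refl J.
Let fsub_comp (J K L : {fset I}) (v : fsub K L) (u : fsub J K) : fsub J L :=
  fsubset_trans u v.

Let fsub_irr (J K : {fset I}) (u v : fsub J K) : u = v.
Proof. exact: bool_irrelevance. Qed.

Definition fsubset_category : category :=
  @Category {fset I} fsub fsub_id fsub_comp
    (fun _ _ _ => fsub_irr _ _) (fun _ _ _ => fsub_irr _ _)
    (fun _ _ _ _ _ _ _ => fsub_irr _ _).

Let fobj (J : {fset I}) : topologicalType :=
  prod_topology (fun j : J => Y (val j)).
Let fmap (J K : {fset I}) (u : fsub J K) (z : fobj J) : fobj K :=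
  fun k : K => base_extend z (val k).

Let fmap_continuous (J K : {fset I}) (u : fsub J K) : continuous (fmap u).
Proof.
apply/prod_topology_continuous => k; rewrite /fmap.
have [kJ|kJ] := boolP (val k \in J).
  have -> : (fun z : fobj J => base_extend z (val k)) = proj [` kJ].
    by apply: funext => z; rewrite (base_extend_in z [` kJ]).
  by have := @proj_continuous _ (fun j : J => Y (val j)) [` kJ].
have -> : (fun z : fobj J => base_extend z (val k)) = cst point.
  by apply: funext => z; rewrite base_extend_out.
exact: cst_continuous.
Qed.

Let fmap_id (J : {fset I}) : fmap (fsub_id J) =1 id.
Proof.
move=> z; apply: functional_extensionality_dep => j; exact: base_extend_in.
Qed.

Let fmap_comp (J K L : {fset I}) (v : fsub K L) (u : fsub J K) :
  fmap (fsub_comp v u) =1 fmap v \o fmap u.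
Proof.
move=> z; apply: functional_extensionality_dep => l /=; rewrite /fmap.
have [lK|lK] := boolP (val l \in K).
  by rewrite (base_extend_in (fmap u z) [` lK]).
rewrite [RHS]base_extend_out // base_extend_out //.
by apply: contra lK; exact: (fsubsetP u).
Qed.

Definition finprod_diagram : diagram fsubset_category :=
  @Diagram fsubset_category fobj fmap fmap_continuous fmap_id fmap_comp.

Lemma finprod_is_colimit :
  @is_colimit fsubset_category finprod_diagram (finprod Y) (@finprod_in I Y).
Proof.
have inE J z i : @finprod_in I Y J z i = base_extend z i by [].
pose supp (y : finprod Y) : {fset I} := fset_set [set i | y i <> point].
pose restr (J : {fset I}) (y : finprod Y) : fobj J := fun j => y (val j).
have restrK (J : {fset I}) (y : finprod Y) :
    (supp y `<=` J)%fset -> finprod_in (restr J y) = y.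
  move=> yJ; apply: finprod_eqP => i; rewrite inE.
  have [iJ|iJ] := boolP (i \in J); first exact: (base_extend_in _ [` iJ]).
  rewrite base_extend_out //; apply: contrapT => yi.
  move/negP: iJ; apply; apply: (fsubsetP yJ).
  rewrite in_fset_set; last exact: finprod_finite.
  by apply/mem_set => /= e; apply: yi; rewrite e.
split; first split.
- exact: final_continuous.
- move=> J K u z; apply: finprod_eqP => i /=.
  have [iK|iK] := boolP (i \in K); first exact: (base_extend_in _ [` iK]).
  rewrite !base_extend_out //.
  by apply: contra iK; exact: (fsubsetP u).
move=> T t [ct tE].
pose h (y : finprod Y) : T := t (supp y) (restr (supp y) y).
have hE J z : h (finprod_in z) = t J z.
  rewrite /h; set K := supp _; set y := finprod_in z.
  have KJ : (K `<=` J)%fset.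
    apply/fsubsetP => i; rewrite in_fset_set; last exact: finprod_finite.
    move=> /set_mem /= zi; apply: contrapT => /negP iJ; apply: zi.
    exact: base_extend_out.
  rewrite -(tE K J KJ (restr K y)) /=; congr (t J _).
  apply: functional_extensionality_dep => j.
  have := congr1 (fun y : finprod_set Y => y (val j)) (restrK K y (fsubset_refl _)).
  by move=> /= e; rewrite [LHS]e; exact: base_extend_in.
exists h; split.
  split; last by move=> J z; exact: hE.
  apply/final_continuousP => J.
  rewrite (_ : h \o _ = t J); first exact: ct.
  by apply: funext => z; exact: hE.
move=> g [_ gE]; apply: funext => y.
rewrite -(restrK (supp y) y (fsubset_refl _)) hE.
by rewrite -gE.
Qed.

End finprod_colimit.

Section exp_union.
Variables (I : choiceType) (X : I -> topologicalType).

(** The coproduct of the [X i] is the library's topology on [{i & X i}], so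
    [X i] is identified with its image under [existT X i]. *)
Definition exp_union_set (S : finprod (fun i => ExpT (X i))) : set {i & X i} :=
  \bigcup_i (existT X i @` [set` (S i : {fset X i})]).

Lemma exp_union_finite S : finite_set (exp_union_set S).
Proof.
rewrite /exp_union_set (_ : \bigcup_i _ =
    \bigcup_(i in [set i | S i <> point])
      (existT X i @` [set` (S i : {fset X i})])).
  apply: bigcup_finite => [|i _]; first exact: finprod_finite.
  exact/finite_image/finite_fset.
apply/seteqP; split=> [p [i _ [x xS <-]]|p [i _ px]]; last by exists i.
by exists i; [move=> /= S0; move: xS; rewrite S0 /= in_fset0|exists x].
Qed.

(** [fset_set] is meaningful only on finite sets, hence [exp_union_finite]. *)
Definition exp_union (S : finprod (fun i => ExpT (X i))) : ExpT {i & X i} :=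
  fset_set (exp_union_set S).

Lemma in_exp_union S (i : I) (x : X i) :
  (existT X i x \in (exp_union S : {fset _})) = (x \in (S i : {fset _})).
Proof.
rewrite in_fset_set; last exact: exp_union_finite.
apply/idP/idP => [/set_mem[j _ [y yS yx]]|xS].
  pose P (p : {i & X i}) := projT2 p \in (S (projT1 p) : {fset _}).
  by have : P (existT X i x) by rewrite -yx.
by apply/mem_set; exists i => //; exists x.
Qed.

End exp_union.

(* Main.v *)
(** The inverse map is continuous with no hypothesis on the [X i]: locally on
    [(coprod X)^n] it factors through a finite product of the [ExpT (X i)].

    For the direct map, write [T] for the coproduct.  On each finite
    product it is an iterated union of maps [ExpT (X i) -> ExpT T], so it suffices
    that union [ExpT T * ExpT T -> ExpT T] is continuous.  A Hausdorff core-compact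
    space has bases of compact neighborhoods, hence so do [T] and its powers.  Given
    [A `|` B] in an open [U], one thickens [[set A]] and [[set B]] alternately: if
    [F] and [G] are compact families whose pairwise unions lie in [U], the tube lemma
    enlarges [F] to a compact [F'] whose trace on [T^m] is a neighborhood of that
    of [F], pairwise unions with [G] still lying in [U].  Letting [m] run infinitely
    often through all the integers, the unions of the two sequences are open.

    To see that [x] in an open [U] has a neighborhood [V] way below [U], consider
    on [set X] the final topology for which every directed open cover of [U]
    converges to [U].  It is a colimit, so by core-compactness membership is open in
    the product of [X] with it; a box around [(x, U)] inside the membership relation
    gives [V]. *)

Require Import Defs.
From HB Require Import structures.
From mathcomp Require Import all_boot all_order finmap.
From mathcomp Require Import all_classical.
From mathcomp Require Import topology.

Set Implicit Arguments.
Unset Strict Implicit.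
Unset Printing Implicit Defensive.

Local Open Scope fset_scope.
Local Open Scope classical_set_scope.

(** * Core-compactness tested on a colimit of net topologies *)

(** The shape of a family of maps [D None -> D (Some k)] out of one object. *)
Section fan_category.
Variable K : Type.

Let fan_hom (a b : option K) : Prop := a = None \/ a = b.

Let fan_id a : fan_hom a a := or_intror erefl.

Let fan_comp a b c (v : fan_hom b c) (u : fan_hom a b) : fan_hom a c.
Proof. by case: u => [->|->]; [left|exact: v]. Qed.

Definition fan_category : category :=
  @Category (option K) fan_hom fan_id fan_comp
    (fun _ _ _ => Prop_irrelevance _ _) (fun _ _ _ => Prop_irrelevance _ _)
    (fun _ _ _ _ _ _ _ => Prop_irrelevance _ _).

End fan_category.

Section net_topology_family.
Variables (X : topologicalType) (U : set X).

Definition directed_cover (P : set_system X) : Prop :=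
  [/\ P set0, setU_closed P, P `<=` open & \bigcup_(D in P) D = U].

(** For [a = Some P], the points other than [U] are isolated and the net [P], directed
    by inclusion, converges to [U]; for [a = None] all points are isolated. *)
Definition net_topology (a : option {P | directed_cover P}) : Type := set X.

Section net_topology.
Variable a : option {P | directed_cover P}.
Local Notation T := (net_topology a).

Definition net_open : set_system T := [set G |
  if a is Some P then G U ->
    exists2 D, sval P D & forall D', sval P D' -> D `<=` D' -> G D'
  else True].

Let net_openT : net_open setT.
Proof. by rewrite /net_open; case: a => [[P [P0 _ _ _]]|]//= _; exists set0. Qed.

Let net_openI : setI_closed net_open.
Proof.
rewrite /net_open => G H; case: a => [[P [_ PU _ _]]|]//= oG oH [GU HU].
have [[D PD DG] [E PE EH]] := (oG GU, oH HU).
exists (D `|` E); first exact: PU.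
by move=> F PF; rewrite subUset => -[DF EF]; split; [exact: DG|exact: EH].
Qed.

Let net_open_bigU (J : Type) (g : J -> set T) :
  (forall j, net_open (g j)) -> net_open (\bigcup_j g j).
Proof.
rewrite /net_open; case: a => [P|]//= og [j _ /og[D PD Dg]].
by exists D => // D' PD' DD'; exists j => //; exact: Dg.
Qed.

HB.instance Definition _ := Choice.copy T (set X).
HB.instance Definition _ :=
  isOpenTopological.Build T net_openT net_openI net_open_bigU.

Lemma net_openE : open = net_open.
Proof. by []. Qed.

End net_topology.

Let K := fan_category {P | directed_cover P}.

Let net_map (a b : K) (u : cat_hom a b) (W : net_topology a) :
  net_topology b := W.

Let net_map_continuous a b (u : cat_hom a b) : continuous (net_map u).
Proof.
apply/continuousP => G; rewrite !net_openE.
by case: u => [|] => [e|e]; subst a.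
Qed.

Definition net_diagram : diagram K :=
  @Diagram K net_topology net_map net_map_continuous
    (fun _ _ => erefl) (fun _ _ _ _ _ _ => erefl).

Definition cover_topology : Type :=
  @final_topology K net_topology (set X) (fun a => id).

HB.instance Definition _ := Topological.on cover_topology.

Let cover_topology_in (a : K) (W : net_topology a) : cover_topology := W.

(** The transition maps are identities out of the discrete [None] object, so a cocone is a single
    function on [set X], and the final topology decides its continuity. *)
Lemma cover_topology_is_colimit :
  @is_colimit K net_diagram cover_topology cover_topology_in.
Proof.
split; first by split=> [a|//]; exact: final_continuous.
move=> T t [ct tE].
have tN a (W : set X) : t a W = t None W by exact: (tE None a (or_introl erefl)).
exists (t None); split; last first.
  by move=> h [_ hE]; apply: funext => W; rewrite -(hE None).
split=> [|a W]; last by rewrite /= tN.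
apply/final_continuousP => a; rewrite (_ : _ \o _ = t a); first exact: ct.
by apply: funext => W; rewrite [RHS]tN.
Qed.

Lemma core_compact_directed_cover x : core_compact X -> open U -> U x ->
  exists2 V : set X, nbhs x V & forall P, directed_cover P ->
    exists2 D, P D & V `<=` D.
Proof.
move=> ccX oU Ux.
(* [Z] carries the final topology from the products; core-compactness makes the identity from
   [X * cover_topology] to [Z] continuous. *)
pose f (a : K) (p : X * net_topology a) : X * set X := p.
pose Z := @final_topology K (fun a => X * net_topology a)%type (X * set X)%type f.
have [_ /(_ Z f)] := ccX _ _ _ _ cover_topology_is_colimit.
have fcocone : @is_cocone _ (prod_diagram X net_diagram) Z f.
  split=> [a|a b u [] //]; exact: (@final_continuous K _ (X * set X)%type f a).
case/(_ fcocone) => h [[ch hE] _].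
(* The set [p.2] is asked to be open so that, when it is isolated, [p.2] times its singleton is a
   neighborhood inside [E]. *)
pose E : set Z := [set p | open p.2 /\ p.2 p.1].
have oE : open E.
  rewrite final_openE => a; rewrite openE => -[y W] /= [oW Wy].
  have [WU|WU] := eqVneq W U; last first.
    exists (W, [set W]) => /=; last by case=> y' W' /= [Wy' ->].
    split; first exact: open_nbhs_nbhs.
    apply: open_nbhs_nbhs; split=> //; rewrite net_openE /net_open /=.
    by case: a W oW Wy WU => [P|] W //= oW Wy WU UW; rewrite UW eqxx in WU.
  case: a W oW Wy WU => [P|] W oW Wy /= WU; last first.
    exists (W, [set W]) => /=; last by case=> y' W' /= [Wy' ->].
    by split; exact: open_nbhs_nbhs.
  have [P0 PU Po Pcover] := svalP P.
  move: (Wy); rewrite WU -{1}Pcover => -[D PD Dy].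
  (* The second factor contains every member of [P] past [D], so it is a neighborhood of [U]. *)
  exists (D, [set W' | open W' /\ D `<=` W']) => /=; last first.
    by case=> y' W' /= [Dy' [oW' DW']]; split=> //; exact: DW'.
  split; first by apply: open_nbhs_nbhs; split=> //; exact: Po.
  apply: open_nbhs_nbhs; split.
    rewrite net_openE /net_open /= => _; exists D => // D' PD' DD'.
    by split=> //; exact: Po.
  by split=> //; rewrite -Pcover; exact: bigcup_sup.
have hid p : h p = p.
  by case: p => y W; have := hE None (y, W).
have : nbhs ((x, U) : X * cover_topology) E.
  have -> : E = h @^-1` E by apply/seteqP; split=> p /=; rewrite hid.
  apply: ch; rewrite hid; exact: open_nbhs_nbhs.
case=> -[V G] /= [nV nG] VGE; exists V => // P PU.
move: nG; rewrite nbhsE => -[G' [+ G'U] G'G].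
(* Openness of [G'] for the net [P] yields a member [D] of [P] in [G']; then [V] times [[set D]]
   lies in [E]. *)
rewrite final_openE => /(_ (Some (exist _ P PU)) G'U) /= [D PD DG].
exists D => // y Vy.
by have /VGE [] : (V `*` G) (y, D) by split=> //; apply: G'G; exact: DG.
Qed.
End net_topology_family.

(** * The way-below relation and compact neighborhoods *)

(** Every open cover of [U] has a finite subfamily covering [V], phrased with the
    ideal [P] of the sets covered by finitely many members. *)
Definition way_below (X : topologicalType) (V U : set X) : Prop :=
  forall P : set_system X,
    P set0 -> setU_closed P -> (forall A B, A `<=` B -> P B -> P A) ->
    (forall y, U y -> exists2 D, nbhs y D & P D) -> P V.

(** The open subsets of [U] that belong to the ideal form a directed cover of [U]. *)
Lemma core_compact_way_below (X : topologicalType) (U : set X) x :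
    core_compact X -> open U -> U x ->
  exists2 V : set X, nbhs x V & way_below V U.
Proof.
move=> ccX oU Ux; have [V nV VP] := core_compact_directed_cover ccX oU Ux.
exists V => // P P0 PU Psub Pcover.
have [|D [oD DU PD] VD] := VP [set D | [/\ open D, D `<=` U & P D]].
  split.
  - by split=> //; exact: open0.
  - move=> A B [oA AU PA] [oB BU PB].
    by split; [exact: openU|rewrite subUset|exact: PU].
  - by move=> A [].
  - apply/seteqP; split=> [y [D [_ DU _]] /DU//|y Uy].
    have [D nD PD] := Pcover y Uy; exists (D° `&` U); last first.
      by split=> //; exact: nbhs_singleton (nbhs_interior nD).
    split; [apply: openI => //; exact: open_interior|exact: subIsetr|].
    by apply: Psub PD => z [/interior_subset].
exact: Psub PD.
Qed.

(** Given [y] outside [U], each point of [U] has a neighborhood whose closure misses [y]; such sets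
    form an ideal, so [closure V] misses [y] too. *)
Lemma way_below_closure (X : topologicalType) (V U : set X) :
  hausdorff_space X -> way_below V U -> closure V `<=` U.
Proof.
move=> hX VU y clVy; apply: contrapT => Uy.
apply: (VU [set D | ~ closure D y]) => //.
- by rewrite /= closure0.
- by move=> A B; rewrite /= closureU => ? ? [].
- by move=> A B AB /=; apply: contra_not; exact: closure_subset.
move=> z Uz; have zy : z != y by apply/eqP => zy; apply: Uy; rewrite -zy.
move: hX; rewrite open_hausdorff => /(_ _ _ zy)[[A B] /= [zA yB] [oA oB /eqP AB0]].
exists A; first by apply: open_nbhs_nbhs; split=> //; exact/set_mem.
move=> /(_ B) [|w [Aw Bw]]; last by rewrite -[False]/(set0 w) -AB0.
by apply: open_nbhs_nbhs; split=> //; exact/set_mem.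
Qed.

(** If a filter [F] on [closure V] had no cluster point there, the sets with complement in [F] would
    form an ideal covering [U] locally. Then [W] would be one of them, although it contains
    [closure V]. *)
Lemma way_below_compact (X : topologicalType) (V W U : set X) :
    hausdorff_space X -> way_below V W -> way_below W U ->
  compact (closure V).
Proof.
move=> hX /(way_below_closure hX) VW WU F FF FV; apply: contrapT => Fcl.
apply: (@filter_not_empty _ F FF); rewrite -(setICr (closure V)).
apply: filterI => //; apply: filterS (subsetC VW) _.
apply: (WU [set D | F (~` D)]) => /=.
- by rewrite setC0; exact: filterT.
- by move=> A B /= FA FB; rewrite setCU; exact: filterI.
- by move=> A B AB; exact/filterS/subsetC.
move=> y Uy; have [clVy|clVy] := pselect (closure V y); last first.
  exists (~` closure V); last by rewrite setCK.
  by apply: open_nbhs_nbhs; split=> //; exact/closed_openC/closed_closure.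
apply: contrapT => nD; apply: Fcl; exists y; split=> // A B FA nB.
apply: contrapT => AB0; apply: nD; exists B => //.
by apply: filterS FA => z Az Bz; apply: AB0; exists z.
Qed.

Definition compact_nbhs_basis (X : topologicalType) : Prop :=
  forall (x : X) (U : set X), nbhs x U ->
    exists K, [/\ nbhs x K, compact K & K `<=` U].

(** An intermediate [W] is chosen because compactness of [closure V] takes two successive way-below
    relations. *)
Lemma core_compact_nbhs_basis (X : topologicalType) :
  hausdorff_space X -> core_compact X -> compact_nbhs_basis X.
Proof.
move=> hX ccX x U /nbhs_interior xU.
have [W xW WU] := core_compact_way_below ccX (open_interior U) (nbhs_singleton xU).
have [V xV VW] :=
  core_compact_way_below ccX (open_interior W) (nbhs_singleton (nbhs_interior xW)).
have {}VW : way_below V W.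
  move=> P P0 PU Psub Pcover; apply: VW => // y /interior_subset; exact: Pcover.
exists (closure V); split.
- by apply: filterS xV; exact: subset_closure.
- exact: way_below_compact VW WU.
- apply: subset_trans (way_below_closure hX VW) _.
  apply: subset_trans (@subset_closure _ W) _.
  apply: subset_trans (way_below_closure hX WU) _; exact: interior_subset.
Qed.

(** * Compact neighborhoods in coproducts and finite powers *)

Lemma sigT_hausdorff (I : choiceType) (X : I -> topologicalType) :
  (forall i, hausdorff_space (X i)) -> hausdorff_space {i & X i}.
Proof.
move=> hX [i x] [j y] xy.
have nbhs_fiber k (z : X k) : nbhs (existT X k z) [set p | projT1 p = k].
  by rewrite /nbhs /= sigT_nbhsE; exact: nearW.
have ij : i = j.
  by have [p [/= <- <-]] := xy _ _ (nbhs_fiber i x) (nbhs_fiber j y).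
subst j; suff -> : x = y by []; apply: hX => A B xA yB.
have [_ [[z Az <-] [w Bw wz]]] :=
  xy _ _ (existT_nbhs _ _ _ xA) (existT_nbhs _ _ _ yB).
by exists z; split=> //; rewrite -(existT_inj2 wz).
Qed.

Lemma sigT_compact_nbhs_basis (I : choiceType) (X : I -> topologicalType) :
  (forall i, compact_nbhs_basis (X i)) -> compact_nbhs_basis {i & X i}.
Proof.
move=> cX [i x] U; rewrite /nbhs /= sigT_nbhsE => /cX[K [xK cK KU]].
exists (existT X i @` K); split; first exact: existT_nbhs.
  apply: continuous_compact cK.
  exact/continuous_subspaceT/existT_continuous.
by move=> _ [y Ky <-]; exact: KU.
Qed.

(** If [C] were outside the ideal, the sets whose complement in [C] lies in it would form a proper
    filter, and a cluster point in [C] would contradict the local covering. *)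
Lemma compact_way_below (X : topologicalType) (C : set X) :
  compact C -> way_below C C.
Proof.
move=> cC P P0 PU Psub Pcover; apply: contrapT => PC.
pose F : set_system X := [set A | P (C `\` A)].
have FF : ProperFilter F.
  apply: Build_ProperFilter_ex => [A FA|].
    apply: contrapT => A0; apply: PC; apply: Psub FA => x Cx; split=> // Ax.
    by apply: A0; exists x.
  split=> [|A B FA FB|A B AB]; rewrite /F /=.
  - by rewrite setDT.
  - by rewrite setDIr; exact: PU.
  - by apply: Psub; exact: setDS.
have [|x [Cx xF]] := cC F FF; first by rewrite /F /= setDv.
have [D xD PD] := Pcover x Cx.
have FD : F (~` D) by apply: Psub PD => y [_ /contrapT].
by have [y []] := xF _ _ FD xD.
Qed.

(** The sets [A] with a compact [K] inside [W] that is a neighborhood of each point of [A] form an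
    ideal covering [C] locally; [compact_way_below] concludes. *)
Lemma compact_nbhs (X : topologicalType) (C W : set X) :
    compact_nbhs_basis X -> compact C -> (forall x, C x -> nbhs x W) ->
  exists K, [/\ compact K, K `<=` W & forall x, C x -> nbhs x K].
Proof.
move=> bX cC CW; apply: (compact_way_below cC
    (P := [set A | exists K, [/\ compact K, K `<=` W & forall x, A x -> nbhs x K]])).
- by exists set0; split=> //; exact: compact0.
- move=> A B [K [cK KW AK]] [L [cL LW BL]]; exists (K `|` L); split.
  + exact: compactU.
  + by rewrite subUset.
  + by move=> x [/AK|/BL]; apply: filterS => y; [left|right].
- by move=> A B AB [K [cK KW BK]]; exists K; split=> // x /AB/BK.
move=> x /CW/bX[K [xK cK KW]]; exists K°; first exact: nbhs_interior.
by exists K; split.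
Qed.

(** The sets containing a box around [x] form a filter; the topology being a supremum, its
    convergence to [x] is checked one coordinate at a time. *)
Lemma nbhs_ptws_box (X : topologicalType) (n : nat) (x : {ptws 'I_n -> X}) U :
  nbhs x U -> exists2 V : 'I_n -> set X, forall i, nbhs (x i) (V i) &
    [set y | forall i, V i (y i)] `<=` U.
Proof.
pose F : set_system {ptws 'I_n -> X} :=
  [set A | exists2 V : 'I_n -> set X, forall i, nbhs (x i) (V i) &
    [set y | forall i, V i (y i)] `<=` A].
have FF : Filter F.
  split=> [|A B [V xV VA] [W xW WB]|A B AB [V xV VA]].
  - by exists (fun=> setT) => // i; exact: filterT.
  - exists (fun i => V i `&` W i) => [i|y VW]; first exact: filterI.
    by split; [apply: VA => i; case: (VW i)|apply: WB => i; case: (VW i)].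
  - by exists V => //; exact: subset_trans AB.
suff: F --> x by apply.
apply/cvg_sup => i A; rewrite nbhsE => -[_ [[B oB <-] /= Bx] BA].
exists (fun j => if j == i then B else setT) => [j|y /(_ i)].
  by case: eqVneq => [->|_]; [exact: open_nbhs_nbhs|exact: filterT].
by rewrite eqxx => By; exact: BA.
Qed.

Lemma nbhs_ptws (X : topologicalType) (n : nat) (x : {ptws 'I_n -> X}) V :
  (forall i, nbhs (x i) (V i)) -> nbhs x [set y | forall i, V i (y i)].
Proof.
move=> xV.
apply: (@filter_forall {ptws 'I_n -> X} _ (fun i y => V i (y i)) (nbhs x) _) => i.
exact: (@proj_continuous _ (fun=> X) i x _ (xV i)).
Qed.

Lemma ptws_compact_nbhs_basis (X : topologicalType) (n : nat) :
  compact_nbhs_basis X -> compact_nbhs_basis {ptws 'I_n -> X}.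
Proof.
move=> bX x U /nbhs_ptws_box[V xV VU].
have [K KP] := choice (fun i => bX _ _ (xV i)).
exists [set y | forall i, K i (y i)]; split.
- by apply: nbhs_ptws => i; case: (KP i).
- by apply: tychonoff => i; case: (KP i).
- by move=> y Ky; apply: VU => i; case: (KP i) => _ _; exact.
Qed.

(** * Compact families of finite subsets *)

Lemma closed_eqmap (X Y : topologicalType) (f g : X -> Y) :
  hausdorff_space Y -> continuous f -> continuous g -> closed [set x | f x = g x].
Proof.
move=> hY cf cg x clx; apply: hY => A B fxA gxB.
have fgx : nbhs x (f @^-1` A `&` g @^-1` B).
  by apply: filterI; [exact: cf|exact: cg].
have [y /= [fg [Afy Bgy]]] := clx _ fgx.
by exists (f y); split=> //; rewrite fg.
Qed.

Lemma bigcup_finType_compact (X : topologicalType) (J : finType) (F : J -> set X) :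
  (forall j, compact (F j)) -> compact (\bigcup_j F j).
Proof.
move=> cF; rewrite (_ : [set: J] = [set` enum J]); last first.
  by apply/seteqP; split=> // j _; rewrite /= mem_enum.
by rewrite bigcup_seq; apply: bigsetU_compact.
Qed.

Definition reindex (X : topologicalType) (m n : nat) (s : 'I_m -> 'I_n)
  (x : {ptws 'I_n -> X}) : {ptws 'I_m -> X} := fun k => x (s k).

Lemma reindex_continuous (X : topologicalType) (m n : nat) (s : 'I_m -> 'I_n) :
  continuous (@reindex X m n s).
Proof.
apply: prod_topology_continuous => k.
exact: (@proj_continuous _ (fun=> X) (s k)).
Qed.

Lemma in_fset_of_family (X : topologicalType) (n : nat) (x : {ptws 'I_n -> X}) a :
  reflect (exists k, a = x k) (a \in fset_of_family x).
Proof.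
rewrite /fset_of_family; apply: (iffP (imfsetP _ _ _ _)) => [[k _ ->]|[k ->]].
  by exists k.
by exists k.
Qed.

Lemma fset_of_family_surj (X : topologicalType) (A : {fset X}) :
  exists x : {ptws 'I_#|` A| -> X}, fset_of_family x = A.
Proof.
exists (tnth (in_tuple A)); apply/fsetP => a.
apply/in_fset_of_family/idP => [[k ->]|]; first exact: mem_tnth.
by move=> aA; exact/tnthP.
Qed.

Definition expU (X : topologicalType) (p : ExpT X * ExpT X) : ExpT X :=
  ((p.1 : {fset X}) `|` (p.2 : {fset X}))%fset.

Definition cat_family (X : topologicalType) (m n : nat)
    (p : {ptws 'I_m -> X} * {ptws 'I_n -> X}) : {ptws 'I_(m + n) -> X} :=
  fun k => match fintype.split k with inl i => p.1 i | inr j => p.2 j end.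

Lemma cat_family_continuous (X : topologicalType) (m n : nat) :
  continuous (@cat_family X m n).
Proof.
apply: prod_topology_continuous => k p; rewrite /cat_family.
case: (fintype.split k) => i.
  apply: (@continuous_comp _ _ _ fst (fun x : {ptws 'I_m -> X} => x i)).
    exact: cvg_fst.
  exact: (@proj_continuous _ (fun=> X) i).
apply: (@continuous_comp _ _ _ snd (fun x : {ptws 'I_n -> X} => x i)).
  exact: cvg_snd.
exact: (@proj_continuous _ (fun=> X) i).
Qed.

Lemma fset_of_cat_family (X : topologicalType) (m n : nat)
    (p : {ptws 'I_m -> X} * {ptws 'I_n -> X}) :
  fset_of_family (cat_family p) = expU (fset_of_family p.1, fset_of_family p.2).
Proof.
apply/fsetP => a; rewrite in_fsetU; apply/in_fset_of_family/orP => /=.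
  move=> [k ->]; rewrite /cat_family; case: (fintype.split k) => i; [left|right];
  by apply/in_fset_of_family; exists i.
by case=> /in_fset_of_family[i ->]; [exists (lshift n i)|exists (rshift m i)];
  rewrite /cat_family; [have := unsplitK (inl i)|have := unsplitK (inr i)] => /= ->.
Qed.

(** A family is handled through its traces on the powers [X^m]; with the bound on cardinality,
    finitely many powers represent all its members. *)
Definition compact_family (X : topologicalType) (F : set {fset X}) : Prop :=
  (exists N, forall A, F A -> (#|` A| <= N)%N) /\
  forall m, compact (@fset_of_family X m @^-1` F).

Lemma compact_familyU (X : topologicalType) (F G : set {fset X}) :
  compact_family F -> compact_family G -> compact_family (F `|` G).
Proof.
move=> [[M FM] cF] [[N GN] cG]; split=> [|m]; last first.
  by rewrite preimage_setU; exact: compactU.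
exists (maxn M N) => A [/FM|/GN] AN; apply: leq_trans AN _.
  exact: leq_maxl.
exact: leq_maxr.
Qed.

(** Hausdorffness makes each equalizer closed, hence each [E st] compact, so the trace on [X^m] is a
    finite union of continuous images of compact sets. *)
Lemma compact_family_image (X : topologicalType) (n : nat)
    (D : set {ptws 'I_n -> X}) :
  hausdorff_space X -> compact D -> compact_family (@fset_of_family X n @` D).
Proof.
move=> hX cD; split=> [|m].
  exists n => _ [x _ <-]; apply: leq_trans (leq_imfset_card _ _ _) _.
  exact: eq_leq (size_enum_ord n).
pose E (st : {ffun 'I_m -> 'I_n} * {ffun 'I_n -> 'I_m}) :=
  D `&` [set x | reindex st.2 (reindex st.1 x) = x].
have -> : @fset_of_family X m @^-1` (@fset_of_family X n @` D) =
    \bigcup_st (reindex st.1 @` E st).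
  (* [x] and [y] have the same values iff [y = x o s] and [x = y o t]. *)
  apply/seteqP; split=> [y [x Dx xy]|_ [[s t] _ [x [Dx /= stx] <-]]] /=.
    have yx k : exists l, y k = x l.
      by apply/in_fset_of_family; rewrite xy; apply/in_fset_of_family; exists k.
    have xy' l : exists k, x l = y k.
      by apply/in_fset_of_family; rewrite -xy; apply/in_fset_of_family; exists l.
    have [[s sE] [t tE]] := (choice yx, choice xy').
    exists (finfun s, finfun t) => //; exists x.
      by split=> //=; apply: funext => l; rewrite /reindex !ffunE -sE -tE.
    by apply: funext => k; rewrite /reindex ffunE -sE.
  exists x => //; apply/fsetP => a; apply/in_fset_of_family/in_fset_of_family.
    by move=> [l ->]; exists (t l); rewrite -{1}stx.
  by move=> [k ->]; exists (s k).
apply: bigcup_finType_compact => -[s t]; apply: continuous_compact.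
  exact/continuous_subspaceT/reindex_continuous.
apply: compact_closedI => //; apply: closed_eqmap => //.
  exact: (@hausdorff_product _ (fun=> X)).
  by move=> x; apply: continuous_comp; exact: reindex_continuous.
by move=> x; exact: cvg_id.
Qed.

Lemma compact_family1 (X : topologicalType) (A : {fset X}) :
  hausdorff_space X -> compact_family [set A].
Proof.
move=> hX; have [x <-] := fset_of_family_surj A.
rewrite -(image_set1 (@fset_of_family X _)).
by apply: compact_family_image => //; exact: compact_set1.
Qed.

(** * Continuity of the union *)

(** This is the tube lemma along the compact trace of [G] on each power [X^l]. *)
Lemma fset_of_familyU_near (X : topologicalType) (U : set (ExpT X))
    (G : set {fset X}) (m : nat) (x : {ptws 'I_m -> X}) :
    open U -> compact_family G -> (forall B, G B -> U (fset_of_family x `|` B)%fset) ->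
  \forall y \near x, forall B, G B -> U (fset_of_family y `|` B)%fset.
Proof.
move=> oU [[N GN] cG] xU.
(* Lengths up to [N] suffice: a member of [G] has at most [N] elements and is listed by a family of
   exactly that length. *)
have near_l (l : 'I_N.+1) : \forall y \near x, forall z : {ptws 'I_l -> X},
    G (fset_of_family z) -> U (fset_of_family y `|` fset_of_family z)%fset.
  have /compact_near_coveringP/(_ _ (nbhs x)) := cG l.
  move=> /(_ (fun y z => U (fset_of_family y `|` fset_of_family z)%fset) _).
  apply=> z Gz.
  (* Openness comes from concatenation on the powers, since continuity of [expU] is what these
     lemmas lead to. *)
  pose W : set ({ptws 'I_l -> X} * {ptws 'I_m -> X}) :=
    [set p | U (fset_of_family (cat_family p))].
  have oW : open W.
    have cW : continuous ((fun y => fset_of_family y : ExpT X) \o @cat_family X l m).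
      move=> p; apply: continuous_comp; first exact: cat_family_continuous.
      exact: (@final_continuous _ _ _ (@fset_of_family X)).
    by move/continuousP: cW; apply.
  have zxW : nbhs (z, x) W.
    apply: open_nbhs_nbhs; split=> //.
    by rewrite /W /= fset_of_cat_family /expU /= fsetUC; exact: xU.
  apply: filterS zxW => -[z' y] /=.
  by rewrite /W /= fset_of_cat_family /expU /= fsetUC.
apply: filterS (@filter_forall {ptws 'I_m -> X} _ _ (nbhs x) _ near_l) => y yU B GB.
have [z zB] := fset_of_family_surj B.
have lN : (#|` B| < N.+1)%N by rewrite ltnS; exact: GN.
by have := yU (Ordinal lN) z; rewrite zB; exact.
Qed.

(** By the tube lemma [W] is a neighborhood of the trace of [F]; the image of a compact [K] between
    the two is added to [F]. *)
Lemma compact_family_thicken (X : topologicalType) (U : set (ExpT X))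
    (F G : set {fset X}) (m : nat) :
    hausdorff_space X -> compact_nbhs_basis X -> open U ->
    compact_family F -> compact_family G ->
    (forall A B, F A -> G B -> U (A `|` B)%fset) ->
  exists F', [/\ compact_family F', F `<=` F',
    forall A B, F' A -> G B -> U (A `|` B)%fset &
    forall x : {ptws 'I_m -> X}, F (fset_of_family x) ->
      nbhs x (@fset_of_family X m @^-1` F')].
Proof.
move=> hX bX oU cF cG FGU.
pose W : set {ptws 'I_m -> X} :=
  [set y | forall B, G B -> U (fset_of_family y `|` B)%fset].
have [|K [cK KW FK]] := @compact_nbhs _ (@fset_of_family X m @^-1` F) W
    (@ptws_compact_nbhs_basis _ m bX) (cF.2 m).
  by move=> x Fx; apply: fset_of_familyU_near => // B GB; exact: FGU.
exists (F `|` @fset_of_family X m @` K); split=> //.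
- by apply: compact_familyU => //; exact: compact_family_image.
- by move=> A B [FA|[x /KW Wx <-]] GB; [exact: FGU|exact: Wx].
- by move=> x /FK; apply: filterS => y Ky; right; exists y.
Qed.

Lemma expU_continuous (X : topologicalType) :
  hausdorff_space X -> compact_nbhs_basis X -> continuous (@expU X).
Proof.
move=> hX bX [A B] O; rewrite nbhsE => -[U [oU UAB] UO].
pose inv (p : set {fset X} * set {fset X}) := [/\ compact_family p.1,
  compact_family p.2 & forall C D, p.1 C -> p.2 D -> U (C `|` D)%fset].
pose thick m (F F' : set {fset X}) := F `<=` F' /\
  forall x : {ptws 'I_m -> X}, F (fset_of_family x) ->
    nbhs x (@fset_of_family X m @^-1` F').
have step (p : {p | inv p} * nat) : exists q : {p | inv p},
    thick p.2 (sval p.1).1 (sval q).1 /\ thick p.2 (sval p.1).2 (sval q).2.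
  case: p => -[[F G] [cF cG FGU]] m /=.
  have [F' [cF' FF' F'GU mF]] := compact_family_thicken m hX bX oU cF cG FGU.
  (* [G] is thickened against the already enlarged [F'], so the invariant holds for the new pair. *)
  have [|G' [cG' GG' G'FU mG]] := compact_family_thicken m hX bX oU cG cF' _.
    by move=> C D GC FD; rewrite fsetUC; exact: F'GU.
  have I' : inv (F', G').
    by split=> // C D FC GD; rewrite fsetUC; exact: G'FU.
  by exists (exist _ _ I').
have [next nextP] := choice step.
have I0 : inv ([set (A : {fset X})], [set (B : {fset X})]).
  by split; [exact: compact_family1|exact: compact_family1|move=> _ _ -> ->].
(* [logn 2] takes every value infinitely often. *)
pose s := fix s n : {p | inv p} :=
  if n is k.+1 then next (s k, logn 2 n) else exist _ _ I0.
pose growing (pr : set {fset X} * set {fset X} -> set {fset X}) :=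
  forall n, thick (logn 2 n.+1) (pr (sval (s n))) (pr (sval (s n.+1))).
have growing_sub pr k l : growing pr -> (k <= l)%N ->
    pr (sval (s k)) `<=` pr (sval (s l)).
  move=> gpr /subnKC <-; elim: (l - k)%N => [|d IH]; first by rewrite addn0.
  by rewrite addnS; apply: subset_trans IH _; case: (gpr (k + d)%N).
have growing_open pr : growing pr ->
    open (\bigcup_n (pr (sval (s n))) : set (ExpT X)).
  move=> gpr; rewrite final_openE => m; rewrite openE => x [n _ nx].
  (* As [k.+1] is [2 ^ m] times an odd number exceeding [n], stage [k] comes no earlier than [n] and
     thickens the trace on [X^m]. *)
  pose k := (2 ^ m * n.*2.+1).-1.
  have kE : k.+1 = (2 ^ m * n.*2.+1)%N by rewrite prednK // muln_gt0 expn_gt0.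
  have mk : logn 2 k.+1 = m.
    by rewrite kE mulnC logn_Gauss ?pfactorK // coprime2n /= odd_double.
  have nk : (n <= k)%N.
    rewrite -ltnS kE; apply: leq_trans (leq_pmull _ _); last by rewrite expn_gt0.
    by rewrite ltnS -addnn leq_addr.
  have [_] := gpr k; rewrite mk => /(_ x (growing_sub _ _ _ gpr nk _ nx)).
  by apply: filterS => y ky; exists k.+1.
have g1 : growing fst by move=> n; exact: (nextP (s n, logn 2 n.+1)).1.
have g2 : growing snd by move=> n; exact: (nextP (s n, logn 2 n.+1)).2.
exists (\bigcup_n (sval (s n)).1, \bigcup_n (sval (s n)).2) => /=.
  split; apply: open_nbhs_nbhs; split.
  - exact: growing_open g1.
  - by exists 0%N.
  - exact: growing_open g2.
  - by exists 0%N.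
case=> C D /= [[k _ kC] [l _ lD]]; apply: UO.
have [_ _] := svalP (s (maxn k l)); apply.
  exact: growing_sub g1 (leq_maxl _ _) _ kC.
exact: growing_sub g2 (leq_maxr _ _) _ lD.
Qed.

(** * Continuity of the direct map *)

Definition exp_map (X Y : topologicalType) (f : X -> Y) (S : ExpT X) : ExpT Y :=
  [fset f x | x in (S : {fset X})]%fset.

Lemma exp_map_continuous (X Y : topologicalType) (f : X -> Y) :
  continuous f -> continuous (exp_map f).
Proof.
move=> cf; apply/final_continuousP => n.
pose fn (x : {ptws 'I_n -> X}) : {ptws 'I_n -> Y} := f \o x.
have -> : exp_map f \o @fset_of_family X n = @fset_of_family Y n \o fn.
  apply: funext => x; apply/fsetP => y; apply/imfsetP/in_fset_of_family => /=.
    by move=> [_ /in_fset_of_family[k ->] ->]; exists k.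
  by move=> [k ->]; exists (x k) => //; apply/in_fset_of_family; exists k.
move=> x; apply: continuous_comp; last first.
  exact: (@final_continuous _ _ _ (@fset_of_family Y)).
move: x; apply: prod_topology_continuous => k x.
by apply: continuous_comp; [exact: (@proj_continuous _ (fun=> X) k)|exact: cf].
Qed.

Lemma pair_continuous (X Y Z : topologicalType) (f : X -> Y) (g : X -> Z) :
  continuous f -> continuous g -> continuous (fun x => (f x, g x)).
Proof. by move=> cf cg x; apply: cvg_pair; [exact: cf|exact: cg]. Qed.

Section exp_coproduct.
Variables (I : choiceType) (X : I -> topologicalType).
Local Notation T := {i & X i}.

Lemma exp_union_continuous : hausdorff_space T -> compact_nbhs_basis T ->
  continuous (@exp_union I X).
Proof.
move=> hT bT; apply/final_continuousP => J.
pose join (s : seq J) (z : prod_topology (fun j : J => ExpT (X (val j)))) : ExpT T :=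
  foldr (fun j S => expU (exp_map (existT X (val j)) (z j), S)) fset0 s.
have in_join s z p : p \in (join s z : {fset T}) =
    has (fun j => p \in (exp_map (existT X (val j)) (z j) : {fset T})) s.
  by elim: s => [|j s IH] /=; rewrite ?in_fset0 // in_fsetU IH.
have -> : @exp_union I X \o @finprod_in I (fun i => ExpT (X i)) J = join (enum {: J}).
  apply: funext => z; apply/fsetP => -[i x]; rewrite in_exp_union in_join /=.
  apply/idP/hasP => [xz|[j _ /imfsetP[/= y yz ixy]]]; last first.
    have ij := congr1 (@projT1 _ _) ixy; rewrite /= in ij; subst i.
    by rewrite (existT_inj2 ixy) base_extend_in.
  have [iJ|iJ] := boolP (i \in J); last by rewrite base_extend_out in xz.
  exists [` iJ]; first by rewrite mem_enum.
  apply/imfsetP; exists x => //=.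
  by rewrite (base_extend_in z [` iJ]) in xz.
elim: (enum {: J}) => [|j s IH]; first exact: cst_continuous.
pose step (z : prod_topology (fun j : J => ExpT (X (val j)))) :=
  (exp_map (existT X (val j)) (z j), join s z).
have cstep : continuous step.
  apply: pair_continuous => // z.
  apply: (@continuous_comp _ _ _
      (fun z : prod_topology (fun j : J => ExpT (X (val j))) => z j)).
    exact: (@proj_continuous _ (fun j : J => ExpT (X (val j))) j).
  exact/exp_map_continuous/existT_continuous.
rewrite (_ : join (j :: s) = @expU T \o step) // => z.
by apply: continuous_comp; [exact: cstep|exact: expU_continuous].
Qed.

(** * Continuity of the inverse map *)

Definition exp_part (i : I) (S : ExpT T) : ExpT (X i) :=
  fset_set [set x | existT X i x \in (S : {fset T})].

Lemma in_exp_part i S x :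
  (x \in (exp_part i S : {fset X i})) = (existT X i x \in (S : {fset T})).
Proof.
rewrite in_fset_set; first by apply/idP/idP => [/set_mem|xS]; [|exact/mem_set].
apply: (@finite_preimage _ _ [set` (S : {fset T})]) => //.
by move=> y z _ _; exact: existT_inj2.
Qed.

(** A left inverse of [existT X i], equal to the default [d] off the fiber; it serves through its
    continuity at points of the fiber. *)
Definition fiber_retract (i : I) (d : X i) (p : T) : X i :=
  xget d [set w | p = existT X i w].

Lemma fiber_retractE i d w : fiber_retract d (existT X i w) = w.
Proof.
rewrite /fiber_retract; case: xgetP => [v _ wv|/(_ w)[]//].
exact: existT_inj2 (esym wv).
Qed.

Lemma fiber_retract_continuous i d w :
  {for existT X i w, continuous (@fiber_retract i d)}.
Proof.
move=> A; rewrite fiber_retractE => wA.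
by rewrite /nbhs /= sigT_nbhsE; apply: filterS wA => v Av /=; rewrite fiber_retractE.
Qed.

(** Fibers are open in the coproduct, so the indices of the coordinates are locally constant. *)
Lemma nbhs_indices n (x : {ptws 'I_n -> T}) :
  nbhs x [set y | forall k, projT1 (y k) = projT1 (x k)].
Proof.
apply: (nbhs_ptws (V := fun k => [set p | projT1 p = projT1 (x k)])) => k.
by case: (x k) => i w; rewrite /nbhs /= sigT_nbhsE; exact: nearW.
Qed.

(** Near [x] the coordinates in the fiber over [i] are those in [J], so the part is the set of
    values of a family in a power of [X i] that depends continuously on [y] at [x]. *)
Lemma exp_part_continuous i : continuous (@exp_part i).
Proof.
apply/final_continuousP => n x.
pose J := {k | projT1 (x k) == i}.
have fiber_elt (k : J) : exists d, x (val k) = existT X i d.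
  by case: k => k /= /eqP; case: (x k) => j w /= ji; subst j; exists w.
have [d dE] := choice fiber_elt.
(* The defaults come from the coordinates of [x], so [X i] may be empty when [J] is. *)
pose h (y : {ptws 'I_n -> T}) : {ptws 'I_#|{: J}| -> X i} :=
  fun p => fiber_retract (d (enum_val p)) (y (val (enum_val p))).
have hE (y : {ptws 'I_n -> T}) : (forall k, projT1 (y k) = projT1 (x k)) ->
    exp_part i (fset_of_family y) = fset_of_family (h y).
  move=> yx; apply/fsetP => w; rewrite in_exp_part.
  apply/in_fset_of_family/in_fset_of_family => [[k yk]|[p ->]].
    have kJ : projT1 (x k) == i by rewrite -yx -yk.
    exists (enum_rank (Sub k kJ : J)).
    by rewrite /h enum_rankK /= -yk fiber_retractE.
  exists (val (enum_val p)); rewrite /h.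
  have := yx (val (enum_val p)); rewrite (eqP (valP (enum_val p))).
  by case: (y _) => j v /= ji; subst j; rewrite fiber_retractE.
have ch : {for x, continuous h}.
  move=> A /nbhs_ptws_box[V hV VA].
  apply: (@filterS {ptws 'I_n -> T} (nbhs x) _ [set y | forall p, V p (h y p)]).
    by move=> y Vy; exact: VA.
  apply: (@filter_forall {ptws 'I_n -> T} _ (fun p y => V p (h y p)) (nbhs x) _) => p.
  apply: (@continuous_comp _ _ _ (fun y : {ptws 'I_n -> T} => y (val (enum_val p)))
      (fiber_retract (d (enum_val p))) x _ _ (V p)).
  - exact: (@proj_continuous _ (fun=> T)).
  - by rewrite dE; exact: fiber_retract_continuous.
  - exact: hV.
move=> A; rewrite /= hE // => hA.
have := @final_continuous _ _ _ (@fset_of_family (X i)) _ (h x) A hA.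
move=> /ch hxA.
apply: (@filterS2 {ptws 'I_n -> T} (nbhs x) _ _ _ _ _ hxA (nbhs_indices x)).
by move=> y hyA /hE /= yE; rewrite /= yE.
Qed.

Lemma exp_part_finite S : finite_set [set i | exp_part i S <> point].
Proof.
apply: (sub_finite_set _ (finite_image (@projT1 _ _) (finite_fset (S : {fset T})))).
move=> i /= /eqP/fset0Pn[x]; rewrite in_exp_part => xS.
by exists (existT X i x).
Qed.

Definition exp_split (S : ExpT T) : finprod (fun i => ExpT (X i)) :=
  Defs.FProd (exp_part_finite S).

(** Near [x] no index outside [J] occurs, so the splitting factors through the finite product over
    [J]. *)
Lemma exp_split_continuous : continuous exp_split.
Proof.
apply/final_continuousP => n x.
pose J : {fset I} := [fset projT1 (x k) | k : 'I_n]%fset.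
pose parts (S : ExpT T) : prod_topology (fun j : J => ExpT (X (val j))) :=
  fun j => exp_part (val j) S.
have cparts : continuous parts.
  by apply: prod_topology_continuous => j; exact: exp_part_continuous.
have cglue : continuous (fun S =>
    finprod_in (parts S) : finprod (fun i => ExpT (X i))).
  move=> S; apply: continuous_comp; first exact: cparts.
  exact: (@final_continuous _ _ _ (@finprod_in I (fun i => ExpT (X i)))).
have {}cglue := (final_continuousP _).1 cglue n x.
have splitE (y : {ptws 'I_n -> T}) : (forall k, projT1 (y k) = projT1 (x k)) ->
    exp_split (fset_of_family y) = finprod_in (parts (fset_of_family y)).
  move=> yx; apply: finprod_eqP => i /=.
  have [iJ|iJ] := boolP (i \in J).
    by rewrite (base_extend_in (parts (fset_of_family y)) [` iJ]).
  rewrite base_extend_out //; apply/eqP; apply: contraNT iJ => /fset0Pn[w].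
  rewrite in_exp_part => /in_fset_of_family[k wk].
  by apply/imfsetP; exists k => //=; rewrite -yx -wk.
move=> A; rewrite /= splitE // => /cglue cA.
apply: (@filterS2 {ptws 'I_n -> T} (nbhs x) _ _ _ _ _ cA (nbhs_indices x)).
by move=> y Ay /splitE /= yE; rewrite /= yE.
Qed.

Lemma exp_unionK : cancel (@exp_union I X) exp_split.
Proof.
move=> S; apply: finprod_eqP => i; apply/fsetP => x.
by rewrite in_exp_part in_exp_union.
Qed.

Lemma exp_splitK : cancel exp_split (@exp_union I X).
Proof. by move=> S; apply/fsetP => -[i x]; rewrite in_exp_union in_exp_part. Qed.

End exp_coproduct.

Theorem proposition2p9 (I : choiceType) (X : I -> topologicalType)
    (hausdorffX : forall i : I, hausdorff_space (X i))
    (core_compactX : forall i : I, core_compact (X i)) :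
  homeomorphism (@exp_union I X).
Proof.
exists (@exp_split I X); split.
- exact: exp_unionK.
- exact: exp_splitK.
- apply: exp_union_continuous; first exact: sigT_hausdorff.
  by apply: sigT_compact_nbhs_basis => i; exact: core_compact_nbhs_basis.
- exact: exp_split_continuous.
Qed.
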